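(* There is an absolute constant $K>0$ such that the following holds. Let $\mathcal{G}=\{G^{(i)}\}_{i=1}^{\infty}$ be a sequence of undirected (not necessarily connected) graphs on a common finite vertex set $V$ with $|V|\ge 2$, and let $P^{(i)}$ be the transition matrix of the lazy random walk on $G^{(i)}$. Suppose that (1) there is a probability distribution $\pi$ on $V$ that is stationary for every $P^{(i)}$; and (2) there are an integer $t\ge1$ and $\lambda>0$ such that for every $i\ge0$ the averaged matrix $\overline{P}^{[i,i+t]}=\frac1t\left(P^{(i+1)}+P^{(i+2)}+\cdots+P^{(i+t)}\right)$ is ergodic and has spectral gap $\lambda(\overline{P}^{[i,i+t]})\ge\lambda$. Then, with $\pi_*=\min_{u\in V}\pi(u)$, $$t_{\mathrm{mix}}(\mathcal{G})\le K\,\frac{t^2\log(1/\pi_* )}{\lambda}.$$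
   Context: The lazy random walk matrix of a graph $G$ is $P(u,u)=1/2$, $P(u,v)=1/(2d_u)$ if $u,v$ adjacent ($d_u$ the degree of $u$ in $G$), $0$ otherwise; at an isolated vertex $u$ the walk stays put, $P(u,u)=1$. The walk on $\mathcal{G}$ uses $P^{(i)}$ at its $i$-th step; $p^{[0,s]}_{u,v}=(P^{(1)}\cdots P^{(s)})(u,v)$ and $\rho^{[0,s]}_{u,\cdot}=p^{[0,s]}_{u,\cdot}/\pi(\cdot)$. With $\|f\|_{2,\pi}=\left(\sum_{x} f(x)^2\pi(x)\right)^{1/2}$, the mixing time is $t_{\mathrm{mix}}(\mathcal{G})=\min\{s:\ \|\rho^{[0,s]}_{u,\cdot}-1\|_{2,\pi}\le 1/3\ \text{for all } u\in V\}$. For a transition matrix $P$ with stationary distribution $\pi$, the Dirichlet form is $\mathcal{E}_P(f,f)=\frac12\sum_{u,v\in V}(f(u)-f(v))^2\pi(u)P(u,v)$ and the spectral gap is $\lambda(P)=\inf\{\mathcal{E}_P(f,f)/\mathrm{Var}_\pi f:\ f:V\to\mathbb{R},\ \mathrm{Var}_\pi f\ne0\}$. *)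

(* Defs.v *)
From HB Require Import structures.
From mathcomp Require Import all_boot all_order all_algebra.
From mathcomp Require Import boolp classical_sets reals constructive_ereal ereal exp.

Set Implicit Arguments.
Unset Strict Implicit.
Unset Printing Implicit Defensive.

Import Order.TTheory GRing.Theory Num.Theory.

Local Open Scope ring_scope.
Local Open Scope classical_set_scope.

Definition undirected_graph (V : finType) (e : rel V) : Prop :=
  symmetric e /\ irreflexive e.

Definition deg (V : finType) (e : rel V) (u : V) : nat := #|[pred v | e u v]|.

(* Matrices with rows and columns indexed by V are functions V -> V -> R. *)
Definition lazy_walk (R : realType) (V : finType) (e : rel V) (u v : V) : R :=
  if u == v then (if deg e u == 0%N then 1 else 1 / 2%:R)
  else if e u v then 1 / (2%:R * (deg e u)%:R)
  else 0.

(* [mat_prod P s] is P 1 * P 2 * ... * P s (the identity if s = 0);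
   P 0 is never used. *)
Fixpoint mat_prod (R : realType) (V : finType) (P : nat -> V -> V -> R)
    (s : nat) (u v : V) : R :=
  if s is s'.+1 then \sum_(w : V) mat_prod P s' u w * P s w v
  else (u == v)%:R.

Definition mat_pow (R : realType) (V : finType) (P : V -> V -> R) (n : nat) :
    V -> V -> R :=
  mat_prod (fun=> P) n.

(* (P (i+1) + ... + P (i+t)) / t *)
Definition mat_avg (R : realType) (V : finType) (P : nat -> V -> V -> R)
    (i t : nat) (u v : V) : R :=
  (\sum_(i.+1 <= j < (i + t).+1) P j u v) / t%:R.

Definition prob_dist (R : realType) (V : finType) (pi : V -> R) : Prop :=
  (forall u, 0 <= pi u) /\ \sum_(u : V) pi u = 1.

Definition stationary (R : realType) (V : finType) (pi : V -> R)
    (P : V -> V -> R) : Prop :=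
  forall v, \sum_(u : V) pi u * P u v = pi v.

Definition irreducible (R : realType) (V : finType) (P : V -> V -> R) : Prop :=
  forall u v, exists n, 0 < mat_pow P n u v.

(* The gcd of the return times {n >= 1 : P^n(u,u) > 0} is 1: they have no
   common divisor other than 1. *)
Definition aperiodic (R : realType) (V : finType) (P : V -> V -> R) : Prop :=
  forall (u : V) (d : nat),
    (forall n, (0 < n)%N -> 0 < mat_pow P n u u -> (d %| n)%N) -> d = 1%N.

Definition ergodic (R : realType) (V : finType) (P : V -> V -> R) : Prop :=
  irreducible P /\ aperiodic P.

Definition mean (R : realType) (V : finType) (pi f : V -> R) : R :=
  \sum_(u : V) f u * pi u.

Definition variance (R : realType) (V : finType) (pi f : V -> R) : R :=
  \sum_(u : V) (f u - mean pi f) ^+ 2 * pi u.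

Definition dirichlet (R : realType) (V : finType) (pi : V -> R)
    (P : V -> V -> R) (f : V -> R) : R :=
  1 / 2%:R * \sum_(u : V) \sum_(v : V) (f u - f v) ^+ 2 * pi u * P u v.

Definition spectral_gap (R : realType) (V : finType) (pi : V -> R)
    (P : V -> V -> R) : R :=
  inf [set dirichlet pi P f / variance pi f
      | f in [set f : V -> R | variance pi f != 0]].

Definition norm2 (R : realType) (V : finType) (pi f : V -> R) : R :=
  Num.sqrt (\sum_(x : V) f x ^+ 2 * pi x).

Definition rho (R : realType) (V : finType) (pi : V -> R)
    (P : nat -> V -> V -> R) (s : nat) (u v : V) : R :=
  mat_prod P s u v / pi v.

(* The minimum of a set of natural numbers, as an infimum in the extended
   reals, so that it is +oo if the walk never mixes. *)
Definition tmix (R : realType) (V : finType) (pi : V -> R)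
    (P : nat -> V -> V -> R) : \bar R :=
  ereal_inf [set (s%:R)%:E
    | s in [set s : nat |
        forall u, norm2 pi (fun v => rho pi P s u v - 1) <= 1 / 3%:R]].

(* The default value 1 is harmless: a probability distribution on a nonempty
   V satisfies pi u <= 1 everywhere. *)
Definition pi_min (R : realType) (V : finType) (pi : V -> R) : R :=
  \big[Num.min/1]_(u : V) pi u.

(* Main.v *)
Require Import Defs.
From HB Require Import structures.
From mathcomp Require Import all_boot all_order all_algebra.
From mathcomp Require Import boolp classical_sets reals constructive_ereal ereal exp.
From mathcomp Require Import sequences ring lra.

Set Implicit Arguments.
Unset Strict Implicit.
Unset Printing Implicit Defensive.

Import Order.TTheory GRing.Theory Num.Theory.

Local Open Scope ring_scope.

(** Stationarity of [pi] for the lazy walk on an undirected graph already forces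
    detailed balance: [pi / deg] is harmonic, so it is constant along edges
    ([stationary_div_deg_adjacent], [lazy_walk_reversible]). By reversibility
    the centred densities [f s = rho s u - 1] evolve by [f s.+1 = P s.+1 (f s)]
    ([rho_step]), where each [P s.+1] is a lazy self-adjoint operator on
    [L2 pi], and it remains to bound how fast the energy [sqnorm pi (f s)]
    decays.

    In one step the energy lost is at least the Dirichlet form of the current
    function, which is itself at least the squared norm of the increment
    [f s - f s.+1] ([dirichlet_le_drop], [sqnorm_sub_act_le]). Thus, if little
    energy is lost during a block of [t] steps, the function hardly moves during
    the block, and every kernel of the block has a small Dirichlet form at the
    initial function of the block, and not only at the function to which it is
    applied. Quantitatively each of these forms is at most [t] times the energy
    lost in the block ([dirichlet_start_le]). Their average is the Dirichlet
    form of the averaged kernel, at least [lambda] times the energy, so a block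
    multiplies the energy by at most [1 - lambda / t] ([block_contraction]).

    The initial energy is [1 / pi u - 1], hence a number of blocks of order
    [t * log (1 / pi_min) / lambda] brings it below [1 / 9]; each block has [t]
    steps, which gives the second factor [t]. *)

(** * Weighted sums *)

(** The difference of the two sides is half the double sum of the nonnegative
    terms [w i * w j * (a i - a j) ^+ 2]. *)
Lemma weighted_cauchy (R : realType) (I : finType) (Q : pred I) (w a : I -> R) :
  (forall i, Q i -> 0 <= w i) ->
  (\sum_(i | Q i) w i * a i) ^+ 2 <=
  (\sum_(i | Q i) w i) * \sum_(i | Q i) w i * a i ^+ 2.
Proof.
move=> w0; set A := \sum_(i | Q i) w i * a i; set W := \sum_(i | Q i) w i.
set B := \sum_(i | Q i) w i * a i ^+ 2.
have : 0 <= \sum_(i | Q i) \sum_(j | Q j) w i * w j * (a i - a j) ^+ 2.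
  apply: sumr_ge0 => i Qi; apply: sumr_ge0 => j Qj.
  by rewrite mulr_ge0 ?sqr_ge0 // mulr_ge0 // w0.
have -> : \sum_(i | Q i) \sum_(j | Q j) w i * w j * (a i - a j) ^+ 2 =
          2%:R * (W * B - A ^+ 2).
  have inner i : \sum_(j | Q j) w i * w j * (a i - a j) ^+ 2 =
                 w i * a i ^+ 2 * W - 2%:R * A * (w i * a i) + w i * B.
    rewrite (eq_bigr (fun j => w i * a i ^+ 2 * w j -
      2%:R * (w i * a i) * (w j * a j) + w i * (w j * a j ^+ 2))); last first.
      by move=> j _; ring.
    by rewrite big_split sumrB -!mulr_sumr /= -/W -/A -/B; ring.
  under eq_bigr => i _ do rewrite inner.
  rewrite big_split /= sumrB -!mulr_suml -mulr_sumr -/W -/A -/B; ring.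
by rewrite pmulr_rge0 ?ltr0n // subr_ge0.
Qed.

Lemma sqr_sum_le (R : realType) (n : nat) (a : nat -> R) :
  (\sum_(k < n) a k) ^+ 2 <= n%:R * \sum_(k < n) a k ^+ 2.
Proof.
have /= := @weighted_cauchy R 'I_n xpredT (fun=> 1) (fun k => a k)
             (fun _ _ => ler01).
rewrite sumr_const card_ord.
under eq_bigr => i _ do rewrite mul1r.
by under [X in _ <= _ * X]eq_bigr => i _ do rewrite mul1r.
Qed.

(** Swapping the two indices negates [f u - f v], so each half of the expanded
    square contributes the same amount. *)
Lemma sum_sqr_sub_symmetric (R : realType) (V : finType) (M : V -> V -> R)
    (f : V -> R) :
  (forall u v, M u v = M v u) ->
  \sum_u \sum_v M u v * (f u - f v) ^+ 2 =
  2%:R * \sum_u \sum_v M u v * (f u * (f u - f v)).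
Proof.
move=> symM; rewrite mulr_natl mulr2n.
rewrite [X in _ = _ + X]exchange_big -big_split /=.
apply: eq_bigr => u _; rewrite -big_split /=; apply: eq_bigr => v _.
by rewrite (symM v u); ring.
Qed.

(** * Lazy reversible kernels *)

Definition sqnorm (R : realType) (V : finType) (pi f : V -> R) : R :=
  \sum_(x : V) f x ^+ 2 * pi x.

Definition act (R : realType) (V : finType) (P : V -> V -> R) (f : V -> R)
    (u : V) : R :=
  \sum_(v : V) P u v * f v.

Record lazy_reversible (R : realType) (V : finType) (pi : V -> R)
    (P : V -> V -> R) : Prop := LazyReversible {
  kernel_ge0 : forall u v, 0 <= P u v;
  kernel_sum1 : forall u, \sum_(v : V) P u v = 1;
  kernel_lazy : forall u, 1 / 2%:R <= P u u;
  kernel_balance : forall u v, pi u * P u v = pi v * P v u }.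

Lemma sqnorm_ge0 (R : realType) (V : finType) (pi f : V -> R) :
  (forall u, 0 <= pi u) -> 0 <= sqnorm pi f.
Proof. by move=> pi0; apply: sumr_ge0 => u _; rewrite mulr_ge0 ?sqr_ge0. Qed.

Lemma dirichlet_ge0 (R : realType) (V : finType) (pi : V -> R)
    (P : V -> V -> R) (f : V -> R) :
  (forall u, 0 <= pi u) -> (forall u v, 0 <= P u v) -> 0 <= dirichlet pi P f.
Proof.
move=> pi0 P0; rewrite mulr_ge0 ?divr_ge0 //.
apply: sumr_ge0 => u _; apply: sumr_ge0 => v _.
by rewrite mulr_ge0 // mulr_ge0 // sqr_ge0.
Qed.

Lemma sub_actE (R : realType) (V : finType) (pi : V -> R) (P : V -> V -> R)
    (f : V -> R) (u : V) :
  lazy_reversible pi P ->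
  f u - act P f u = \sum_(v | v != u) P u v * (f u - f v).
Proof.
move=> HP; rewrite /act -{1}[f u]mul1r -(kernel_sum1 HP u) mulr_suml -sumrB.
rewrite (bigD1 u) //= subrr add0r; apply: eq_bigr => v _; ring.
Qed.

Lemma dirichletE (R : realType) (V : finType) (pi : V -> R) (P : V -> V -> R)
    (f : V -> R) :
  lazy_reversible pi P ->
  dirichlet pi P f = \sum_u f u * (f u - act P f u) * pi u.
Proof.
move=> HP; rewrite /dirichlet.
have -> : \sum_u \sum_v (f u - f v) ^+ 2 * pi u * P u v =
          \sum_u \sum_v pi u * P u v * (f u - f v) ^+ 2.
  by apply: eq_bigr => u _; apply: eq_bigr => v _; ring.
rewrite (sum_sqr_sub_symmetric _ (kernel_balance HP)).
rewrite mulrA divfK ?pnatr_eq0 // mul1r.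
apply: eq_bigr => u _; rewrite (sub_actE _ _ HP) mulr_sumr mulr_suml.
rewrite (bigD1 u) //= subrr !mulr0 add0r; apply: eq_bigr => v _; ring.
Qed.

Lemma kernel_offdiag_le (R : realType) (V : finType) (pi : V -> R)
    (P : V -> V -> R) (u : V) :
  lazy_reversible pi P -> \sum_(v | v != u) P u v <= 1 / 2%:R.
Proof.
move=> HP; have := kernel_sum1 HP u; rewrite (bigD1 u) //=.
have := kernel_lazy HP u; lra.
Qed.

(** [(f u - f v) ^+ 2 <= 2 (f u ^+ 2 + f v ^+ 2)], and the off-diagonal mass
    of each row is at most one half. *)
Lemma dirichlet_le_sqnorm (R : realType) (V : finType) (pi : V -> R)
    (P : V -> V -> R) (f : V -> R) :
  (forall u, 0 <= pi u) -> lazy_reversible pi P ->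
  dirichlet pi P f <= sqnorm pi f.
Proof.
move=> pi0 HP.
pose M u v := if v == u then 0 else pi u * P u v.
have symM u v : M u v = M v u.
  by rewrite /M eq_sym; case: eqP => // _; rewrite (kernel_balance HP).
have M0 u v : 0 <= M u v.
  by rewrite /M; case: eqP => // _; rewrite mulr_ge0 // (kernel_ge0 HP).
have rowM u : \sum_v M u v <= pi u / 2%:R.
  rewrite (bigD1 u) //= {1}/M eqxx add0r.
  rewrite (eq_bigr (fun v => pi u * P u v)); last first.
    by move=> v /negbTE vu; rewrite /M vu.
  rewrite -mulr_sumr ler_wpM2l //.
  by have := kernel_offdiag_le u HP; rewrite div1r.
have -> : dirichlet pi P f =
          1 / 2%:R * \sum_u \sum_v M u v * (f u - f v) ^+ 2.
  congr (_ * _); apply: eq_bigr => u _; apply: eq_bigr => v _.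
  rewrite /M; case: eqP => [->|_]; [by rewrite subrr expr0n /= !mul0r | ring].
have : \sum_u \sum_v M u v * (f u - f v) ^+ 2 <=
       \sum_u \sum_v M u v * (2%:R * f u ^+ 2) +
       \sum_u \sum_v M u v * (2%:R * f v ^+ 2).
  rewrite -big_split; apply: ler_sum => u _; rewrite -big_split.
  apply: ler_sum => v _ /=; rewrite -mulrDr ler_wpM2l //.
  have := sqr_ge0 (f u + f v); rewrite !expr2; nra.
rewrite [X in _ <= _ + X]exchange_big /=.
under [X in _ <= _ + X]eq_bigr => u _ do
  under eq_bigr => v _ do rewrite symM.
have : \sum_u \sum_v M u v * (2%:R * f u ^+ 2) <= sqnorm pi f.
  apply: ler_sum => u _; rewrite -mulr_suml.
  have -> : f u ^+ 2 * pi u = pi u / 2%:R * (2%:R * f u ^+ 2) by field.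
  by rewrite ler_wpM2r // mulr_ge0 ?sqr_ge0.
lra.
Qed.

(** This is where laziness enters through Cauchy-Schwarz: the weight spread by
    [P u] over the points other than [u] is at most one half, which cancels
    against the factor one half of the Dirichlet form. *)
Lemma sqnorm_sub_act_le (R : realType) (V : finType) (pi : V -> R)
    (P : V -> V -> R) (f : V -> R) :
  (forall u, 0 <= pi u) -> lazy_reversible pi P ->
  sqnorm pi (fun u => f u - act P f u) <= dirichlet pi P f.
Proof.
move=> pi0 HP; rewrite /sqnorm /dirichlet mulr_sumr; apply: ler_sum => u _.
rewrite (sub_actE _ _ HP).
have P0 v : v != u -> 0 <= P u v by move=> _; exact: kernel_ge0 HP u v.
have := weighted_cauchy (fun v => f u - f v) P0.
set S := \sum_(v | v != u) P u v * (f u - f v) ^+ 2.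
have S0 : 0 <= S.
  by apply: sumr_ge0 => v _; rewrite mulr_ge0 ?(kernel_ge0 HP) ?sqr_ge0.
have -> : \sum_v (f u - f v) ^+ 2 * pi u * P u v = pi u * S.
  rewrite /S mulr_sumr (bigD1 u) //= subrr expr0n /= !mul0r add0r.
  by apply: eq_bigr => v _; ring.
move=> CS; have : (\sum_(v | v != u) P u v * (f u - f v)) ^+ 2 <= 1 / 2%:R * S.
  by apply: (le_trans CS); rewrite ler_wpM2r // (kernel_offdiag_le _ HP).
move=> {CS} /(ler_wpM2r (pi0 u)); congr (_ <= _); ring.
Qed.

(** With [L = 1 - P], the energy lost is [2 <f, L f> - |L f| ^+ 2], and
    [|L f| ^+ 2] is at most [<f, L f>], the Dirichlet form. *)
Lemma dirichlet_le_drop (R : realType) (V : finType) (pi : V -> R)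
    (P : V -> V -> R) (f : V -> R) :
  (forall u, 0 <= pi u) -> lazy_reversible pi P ->
  dirichlet pi P f <= sqnorm pi f - sqnorm pi (act P f).
Proof.
move=> pi0 HP; have := sqnorm_sub_act_le f pi0 HP.
have -> : sqnorm pi f - sqnorm pi (act P f) =
          2%:R * dirichlet pi P f - sqnorm pi (fun u => f u - act P f u).
  rewrite (dirichletE _ HP) /sqnorm mulr_sumr -!sumrB.
  by apply: eq_bigr => u _; ring.
lra.
Qed.

Lemma dirichlet_sum (R : realType) (V : finType) (pi : V -> R)
    (P : V -> V -> R) (n : nat) (h : nat -> V -> R) :
  (forall u, 0 <= pi u) -> (forall u v, 0 <= P u v) ->
  dirichlet pi P (fun x => \sum_(k < n) h k x) <=
  n%:R * \sum_(k < n) dirichlet pi P (h k).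
Proof.
move=> pi0 P0; rewrite /dirichlet -mulr_sumr mulrCA ler_wpM2l ?divr_ge0 //.
rewrite [X in _ <= _ * X]exchange_big mulr_sumr /=; apply: ler_sum => u _.
rewrite [X in _ <= _ * X]exchange_big mulr_sumr /=; apply: ler_sum => v _.
rewrite -!mulr_suml -sumrB !mulrA !ler_wpM2r //.
exact: (sqr_sum_le n (fun k => h k u - h k v)).
Qed.

(** * Contraction over a block of steps *)

(** Write [f 0] as [f j] plus the increments [f k - f k.+1] with [k < j]. Each
    of these [j.+1] functions has a Dirichlet form bounded by the energy lost
    in one step: the form of [P j.+1] at [f j] by the loss of step [j.+1], and
    the form at an increment by its squared norm, hence by the loss of step
    [k.+1]. Convexity of the square costs the factor [j.+1]. *)
Lemma dirichlet_start_le (R : realType) (V : finType) (pi : V -> R)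
    (P : nat -> V -> V -> R) (f : nat -> V -> R) (j : nat) :
  (forall u, 0 <= pi u) ->
  (forall k, lazy_reversible pi (P k.+1)) ->
  (forall k, f k.+1 = act (P k.+1) (f k)) ->
  dirichlet pi (P j.+1) (f 0%N) <=
  j.+1%:R * (sqnorm pi (f 0%N) - sqnorm pi (f j.+1)).
Proof.
move=> pi0 HP fS.
pose h k x := if k == j then f j x else f k x - f k.+1 x.
have f0E : f 0%N = fun x => \sum_(k < j.+1) h k x.
  apply/funext => x; rewrite big_ord_recr /= {2}/h eqxx.
  rewrite (eq_bigr (fun k : 'I_j => - (f k.+1 x - f k x))); last first.
    by move=> k _; rewrite /h ltn_eqF // opprB.
  rewrite sumrN -(big_mkord xpredT (fun k => f k.+1 x - f k x)).
  by rewrite telescope_sumr // opprB subrK.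
have dropE : sqnorm pi (f 0%N) - sqnorm pi (f j.+1) =
             \sum_(k < j.+1) (sqnorm pi (f k) - sqnorm pi (f k.+1)).
  rewrite -opprB -(telescope_sumr (fun k => sqnorm pi (f k)) (leq0n j.+1)).
  by rewrite big_mkord -sumrN; apply: eq_bigr => k _; rewrite opprB.
rewrite {1}f0E dropE; apply: le_trans (dirichlet_sum j.+1 h pi0 _) _.
  exact: kernel_ge0 (HP j).
rewrite ler_wpM2l //; apply: ler_sum => k _; rewrite fS /h.
case: (nat_of_ord k =P j) => [->|_]; first exact: dirichlet_le_drop.
apply: le_trans (dirichlet_le_sqnorm _ pi0 (HP j)) _.
apply: le_trans (dirichlet_le_drop _ pi0 (HP k)).
by rewrite fS; exact: sqnorm_sub_act_le.
Qed.

Lemma sqnorm_antitone (R : realType) (V : finType) (pi : V -> R)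
    (P : nat -> V -> V -> R) (f : nat -> V -> R) (m n : nat) :
  (forall u, 0 <= pi u) ->
  (forall k, lazy_reversible pi (P k.+1)) ->
  (forall k, f k.+1 = act (P k.+1) (f k)) ->
  (m <= n)%N -> sqnorm pi (f n) <= sqnorm pi (f m).
Proof.
move=> pi0 HP fS; elim: n => [|n IHn]; first by rewrite leqn0 => /eqP->.
rewrite leq_eqVlt => /predU1P[->//|/IHn]; apply: le_trans.
rewrite fS -subr_ge0; apply: le_trans (dirichlet_le_drop _ pi0 (HP n)).
by apply: dirichlet_ge0 => //; exact: kernel_ge0 (HP n).
Qed.

Lemma dirichlet_mat_avg (R : realType) (V : finType) (pi : V -> R)
    (P : nat -> V -> V -> R) (i t : nat) (f : V -> R) :
  dirichlet pi (mat_avg P i t) f =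
  (\sum_(k < t) dirichlet pi (P (i + k).+1) f) / t%:R.
Proof.
rewrite /dirichlet -mulr_sumr -[RHS]mulrA; congr (_ * _).
rewrite [X in _ = X / _]exchange_big mulr_suml /=; apply: eq_bigr => u _.
rewrite [X in _ = X / _]exchange_big mulr_suml /=; apply: eq_bigr => v _.
rewrite /mat_avg -addSn -{1}[i.+1]add0n big_addn addnC addnK big_mkord.
rewrite mulrA mulr_sumr; congr (_ / _); apply: eq_bigr => k _.
by rewrite addnS addnC.
Qed.

Lemma spectral_gap_le (R : realType) (V : finType) (pi : V -> R)
    (P : V -> V -> R) (lambda : R) (f : V -> R) :
  (forall u, 0 <= pi u) -> (forall u v, 0 <= P u v) ->
  lambda <= spectral_gap pi P ->
  lambda * variance pi f <= dirichlet pi P f.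
Proof.
move=> pi0 P0 gap.
have var_ge0 g : 0 <= variance pi g.
  by apply: sumr_ge0 => u _; rewrite mulr_ge0 ?sqr_ge0.
have [->|var0] := eqVneq (variance pi f) 0.
  by rewrite mulr0 dirichlet_ge0.
have varP : 0 < variance pi f by rewrite lt_def var0 var_ge0.
rewrite -ler_pdivlMr //; apply: (le_trans gap); apply: ge_inf.
  by exists 0 => _ [g _ <-]; rewrite divr_ge0 ?dirichlet_ge0.
by exists f.
Qed.

Lemma mat_avg_ge0 (R : realType) (V : finType) (P : nat -> V -> V -> R)
    (i t : nat) (u v : V) :
  (forall k u v, 0 <= P k.+1 u v) -> 0 <= mat_avg P i t u v.
Proof.
move=> P0; rewrite divr_ge0 // big_nat_cond.
by apply: sumr_ge0 => -[|k].
Qed.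

(** Averaging [dirichlet_start_le] over the steps of a block bounds the
    averaged Dirichlet form of [f i] by [t] times the energy lost in the block,
    while the spectral gap bounds it below by [lambda * sqnorm pi (f i)], the
    energy of a mean zero function being its variance. *)
Lemma block_contraction (R : realType) (V : finType) (pi : V -> R)
    (P : nat -> V -> V -> R) (f : nat -> V -> R) (i t : nat) (lambda : R) :
  (forall u, 0 <= pi u) ->
  (forall k, lazy_reversible pi (P k.+1)) ->
  (forall k, f k.+1 = act (P k.+1) (f k)) ->
  mean pi (f i) = 0 ->
  (0 < t)%N ->
  lambda <= spectral_gap pi (mat_avg P i t) ->
  sqnorm pi (f (i + t)%N) <= (1 - lambda / t%:R) * sqnorm pi (f i).
Proof.
move=> pi0 HP fS mean0 t0 gap.
have P0 k u v : 0 <= P k.+1 u v by exact: kernel_ge0 (HP k) u v.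
have avg0 u v : 0 <= mat_avg P i t u v by exact: mat_avg_ge0.
have := spectral_gap_le (f i) pi0 avg0 gap.
have -> : variance pi (f i) = sqnorm pi (f i).
  by apply: eq_bigr => u _; rewrite mean0 subr0.
set D := sqnorm pi (f i) - sqnorm pi (f (i + t)%N).
have tR : 0 < t%:R :> R by rewrite ltr0n.
have avg_le : dirichlet pi (mat_avg P i t) (f i) <= t%:R * D.
  rewrite dirichlet_mat_avg ler_pdivrMr // mulrC.
  apply: le_trans (_ : \sum_(k < t) t%:R * D <= _); last first.
    by rewrite sumr_const card_ord -[X in X <= _]mulr_natl.
  apply: ler_sum => k _.
  have := @dirichlet_start_le R V pi (fun n => P (i + n)%N)
    (fun n => f (i + n)%N) k pi0 _ _.
  rewrite addn0 addnS => start; apply: (le_trans (start _ _)) => [n|n|].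
  - by rewrite addnS.
  - by rewrite !addnS.
  have Dk : sqnorm pi (f i) - sqnorm pi (f (i + k).+1) <= D.
    apply: lerB => //; apply: (sqnorm_antitone pi0 HP fS).
    by rewrite -addnS leq_add2l.
  apply: ler_pM => //; last by rewrite ler_nat.
  rewrite subr_ge0; apply: (sqnorm_antitone pi0 HP fS).
  by rewrite -addnS leq_addr.
move=> /le_trans/(_ avg_le); rewrite mulrC -ler_pdivrMl // => {}avg_le.
suff : lambda / t%:R * sqnorm pi (f i) <= D by rewrite /D; lra.
by move: avg_le; congr (_ <= _); field; rewrite gt_eqF.
Qed.

(** * Lazy random walks *)

Lemma deg_sum (R : realType) (V : finType) (e : rel V) (u : V) :
  (deg e u)%:R = \sum_v (e u v)%:R :> R.
Proof.
rewrite /deg -sum1_card natr_sum [LHS]big_mkcond /=.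
by apply: eq_bigr => v _; rewrite inE; case: (e u v).
Qed.

Lemma adj0_of_deg0 (V : finType) (e : rel V) (u v : V) :
  deg e u = 0%N -> e u v = false.
Proof. by move/card0_eq/(_ v); rewrite inE. Qed.

Lemma lazy_walk_neq (R : realType) (V : finType) (e : rel V) (u v : V) :
  u != v -> lazy_walk R e u v = (e u v)%:R / (2%:R * (deg e u)%:R).
Proof.
by move=> /negbTE uv; rewrite /lazy_walk uv; case: (e u v); rewrite ?mul0r.
Qed.

Lemma lazy_walk_sum1 (R : realType) (V : finType) (e : rel V) (u : V) :
  undirected_graph e -> \sum_v lazy_walk R e u v = 1.
Proof.
case=> _ irr; rewrite (bigD1 u) //= {1}/lazy_walk eqxx.
have -> : \sum_(v | v != u) lazy_walk R e u v =
          (deg e u)%:R / (2%:R * (deg e u)%:R).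
  rewrite {1}deg_sum mulr_suml [RHS](bigD1 u) //= irr mul0r add0r.
  by apply: eq_bigr => v vu; rewrite lazy_walk_neq // eq_sym.
case: eqP => [->|/eqP d0]; first by rewrite mul0r addr0.
by field; rewrite pnatr_eq0.
Qed.

(** The function [g = pi / deg] is harmonic for the walk, hence has zero
    Dirichlet form, hence takes the same value at adjacent vertices. At an
    isolated vertex the division by zero makes [g] vanish whatever [pi] is, but
    there the harmonicity sum has only zero terms. *)
Lemma stationary_div_deg_adjacent (R : realType) (V : finType) (e : rel V)
    (pi : V -> R) (u v : V) :
  undirected_graph e -> stationary pi (lazy_walk R e) -> e u v ->
  pi u / (deg e u)%:R = pi v / (deg e v)%:R.
Proof.
move=> [sym irr] stat.
pose A x y : R := (e x y)%:R; pose g x := pi x / (deg e x)%:R.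
have symA x y : A x y = A y x by rewrite /A sym.
have harmonic x : \sum_y A x y * (g x - g y) = 0.
  have [d0|d0] := eqVneq (deg e x) 0%N.
    by apply: big1 => y _; rewrite /A adj0_of_deg0 // mul0r.
  under eq_bigr => y _ do rewrite mulrBr.
  rewrite sumrB -mulr_suml -deg_sum.
  have := stat x; rewrite (bigD1 x) //= {1}/lazy_walk eqxx (negbTE d0).
  have -> : \sum_(y | y != x) pi y * lazy_walk R e y x =
            1 / 2%:R * \sum_y A x y * g y.
    rewrite mulr_sumr [RHS](bigD1 x) //= /A irr mul0r mulr0 add0r.
    apply: eq_bigr => y yx; rewrite lazy_walk_neq // sym /g invfM; ring.
  have -> : (deg e x)%:R * g x = pi x by rewrite mulrC divfK ?pnatr_eq0.
  lra.
have := sum_sqr_sub_symmetric g symA.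
have -> : \sum_x \sum_y A x y * (g x * (g x - g y)) = 0.
  apply: big1 => x _; under eq_bigr => y _ do rewrite mulrCA.
  by rewrite -mulr_sumr harmonic mulr0.
have A0 x y : 0 <= A x y * (g x - g y) ^+ 2.
  by rewrite mulr_ge0 ?sqr_ge0 // /A ler0n.
rewrite mulr0 => /psumr_eq0P sum0 uv.
have /psumr_eq0P row0 := sum0 (fun x _ => sumr_ge0 _ (fun y _ => A0 x y)) u isT.
have := row0 (fun y _ => A0 u y) v isT.
by rewrite /A uv mul1r => /eqP; rewrite sqrf_eq0 subr_eq0 => /eqP.
Qed.

Lemma lazy_walk_reversible (R : realType) (V : finType) (e : rel V)
    (pi : V -> R) :
  undirected_graph e -> stationary pi (lazy_walk R e) ->
  lazy_reversible pi (lazy_walk R e).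
Proof.
move=> ge stat; split.
- move=> u v; rewrite /lazy_walk; case: ifP => _; case: ifP => _ //.
- by move=> u; exact: lazy_walk_sum1.
- by move=> u; rewrite /lazy_walk eqxx; case: ifP => _; lra.
move=> u v; have [->//|uv] := eqVneq u v.
rewrite !lazy_walk_neq // 1?eq_sym //.
have [sym _] := ge; rewrite (sym v u); case euv: (e u v); last first.
  by rewrite !mul0r !mulr0.
have := stationary_div_deg_adjacent ge stat euv.
rewrite !invfM !mul1r mulrCA => ->; ring.
Qed.

(** * The density of the walk relative to the stationary distribution *)

Lemma stationary_mat_pow (R : realType) (V : finType) (pi : V -> R)
    (P : V -> V -> R) (n : nat) :
  stationary pi P -> stationary pi (mat_pow P n).
Proof.
move=> stat; elim: n => [|n IHn] v; rewrite /mat_pow /=.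
  rewrite (bigD1 v) //= eqxx mulr1 big1 ?addr0 // => u /negbTE ->.
  by rewrite mulr0.
under eq_bigr => u _ do rewrite mulr_sumr.
rewrite exchange_big /= -[RHS]stat; apply: eq_bigr => w _.
rewrite -[in RHS]IHn mulr_suml; apply: eq_bigr => u _.
by rewrite mulrA.
Qed.

Lemma mat_pow_ge0 (R : realType) (V : finType) (P : V -> V -> R) (n : nat)
    (u v : V) :
  (forall u v, 0 <= P u v) -> 0 <= mat_pow P n u v.
Proof.
move=> P0; elim: n u v => [|n IHn] u v; first exact: ler0n.
by apply: sumr_ge0 => w _; rewrite mulr_ge0 // IHn.
Qed.

(** Some [u] carries mass, and the power [n] of [P] that charges [v] from [u]
    moves a positive part of it to [v] while preserving [pi]. *)
Lemma stationary_gt0 (R : realType) (V : finType) (pi : V -> R)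
    (P : V -> V -> R) (v : V) :
  prob_dist pi -> (forall u v, 0 <= P u v) -> irreducible P ->
  stationary pi P -> 0 < pi v.
Proof.
move=> [pi0 pi1] P0 irr stat.
have [u piu] : exists u, 0 < pi u.
  apply: contrapT => none; move/eqP: pi1; rewrite big1 => [|u _].
    by rewrite eq_sym oner_eq0.
  apply/eqP; rewrite eq_le pi0 andbT leNgt.
  by apply/negP => piu; apply: none; exists u.
have [n Pn] := irr u v; rewrite -(stationary_mat_pow n stat v) (bigD1 u) //=.
rewrite ltr_pwDl ?mulr_gt0 //; apply: sumr_ge0 => w _.
by rewrite mulr_ge0 // mat_pow_ge0.
Qed.

Lemma stationary_mat_avg (R : realType) (V : finType) (pi : V -> R)
    (P : nat -> V -> V -> R) (i t : nat) :
  (0 < t)%N -> (forall k, stationary pi (P k.+1)) ->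
  stationary pi (mat_avg P i t).
Proof.
move=> t0 stat v; rewrite /mat_avg.
under eq_bigr => u _ do rewrite mulrA mulr_sumr.
rewrite -mulr_suml exchange_big /= big_add1 /=.
under eq_bigr => k _ do rewrite stat.
by rewrite sumr_const_nat addKn -[X in X / _]mulr_natr mulfK // pnatr_eq0 -lt0n.
Qed.

Lemma mat_prod_sum1 (R : realType) (V : finType) (P : nat -> V -> V -> R)
    (s : nat) (u : V) :
  (forall k u, \sum_v P k.+1 u v = 1) -> \sum_v mat_prod P s u v = 1.
Proof.
move=> P1; elim: s => [|s IHs] /=.
  rewrite (bigD1 u) //= eqxx big1 ?addr0 // => v.
  by rewrite eq_sym => /negbTE ->.
rewrite exchange_big /= -IHs; apply: eq_bigr => w _.
by rewrite -mulr_sumr P1 mulr1.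
Qed.

(** Detailed balance turns the row vector recursion for [mat_prod] into the
    action of the kernel on functions. *)
Lemma rho_step (R : realType) (V : finType) (pi : V -> R)
    (P : nat -> V -> V -> R) (s : nat) (u : V) :
  (forall v, 0 < pi v) -> lazy_reversible pi (P s.+1) ->
  (fun v => rho pi P s.+1 u v - 1) =
  act (P s.+1) (fun v => rho pi P s u v - 1).
Proof.
move=> pi0 HP; apply/funext => v; rewrite /act /rho /=.
under [RHS]eq_bigr => w _ do rewrite mulrBr mulr1.
rewrite sumrB (kernel_sum1 HP) mulr_suml; congr (_ - _).
apply: eq_bigr => w _; rewrite mulrCA -mulrA; congr (_ * _).
apply/eqP; rewrite eqr_div ?lt0r_neq0 //; apply/eqP.
by rewrite mulrC (kernel_balance HP) mulrC.
Qed.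

Lemma mean_rho_sub1 (R : realType) (V : finType) (pi : V -> R)
    (P : nat -> V -> V -> R) (s : nat) (u : V) :
  (forall v, 0 < pi v) -> \sum_v pi v = 1 ->
  (forall k u, \sum_v P k.+1 u v = 1) ->
  mean pi (fun v => rho pi P s u v - 1) = 0.
Proof.
move=> pi0 pi1 P1; rewrite /mean /rho.
rewrite (eq_bigr (fun v => mat_prod P s u v - pi v)).
  by rewrite sumrB pi1 (mat_prod_sum1 _ _ P1) subrr.
by move=> v _; rewrite mulrBl mul1r divfK // gt_eqF.
Qed.

Lemma sqnorm_rho0 (R : realType) (V : finType) (pi : V -> R)
    (P : nat -> V -> V -> R) (u : V) :
  (forall v, 0 < pi v) -> \sum_v pi v = 1 ->
  sqnorm pi (fun v => rho pi P 0 u v - 1) = 1 / pi u - 1.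
Proof.
move=> pi0 pi1; rewrite /sqnorm /rho /= (bigD1 u) //= eqxx /= mulr1n.
rewrite (eq_bigr pi) => [|v]; last first.
  by rewrite eq_sym => /negbTE ->; rewrite mul0r sub0r sqrrN expr1n mul1r.
have -> : \sum_(v | v != u) pi v = 1 - pi u.
  by rewrite -pi1 [X in _ = X - _](bigD1 u) //= addrAC subrr add0r.
by field; rewrite gt_eqF.
Qed.

Lemma sqnorm_rho_blocks (R : realType) (V : finType) (pi : V -> R)
    (P : nat -> V -> V -> R) (t m : nat) (lambda : R) (u : V) :
  (forall v, 0 < pi v) -> \sum_v pi v = 1 ->
  (forall k, lazy_reversible pi (P k.+1)) ->
  (0 < t)%N -> lambda / t%:R <= 1 ->
  (forall i, lambda <= spectral_gap pi (mat_avg P i t)) ->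
  sqnorm pi (fun v => rho pi P (m * t) u v - 1) <=
  (1 - lambda / t%:R) ^+ m * (1 / pi u - 1).
Proof.
move=> pi0 pi1 HP t0 lt1 gap.
have piW v : 0 <= pi v by exact: ltW.
have P1 k x : \sum_v P k.+1 x v = 1 by exact: kernel_sum1 (HP k) x.
elim: m => [|m IHm]; first by rewrite mul0n expr0 mul1r sqnorm_rho0.
have step := @block_contraction R V pi P (fun s v => rho pi P s u v - 1)
  (m * t) t lambda piW HP (fun k => rho_step u pi0 (HP k)).
rewrite mulSn addnC exprS -mulrA.
apply: (le_trans (step (mean_rho_sub1 _ _ pi0 pi1 P1) t0 (gap _))).
by rewrite ler_wpM2l // subr_ge0.
Qed.

(** One block cannot lose more than the initial energy [1 / pi u - 1 > 0]. This
    keeps the contraction factor nonnegative, so that it can be iterated, and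
    lets the final bound absorb one additional block. *)
Lemma gap_le_block_length (R : realType) (V : finType) (pi : V -> R)
    (P : nat -> V -> V -> R) (t : nat) (lambda : R) (u : V) :
  (forall v, 0 < pi v) -> \sum_v pi v = 1 -> pi u < 1 ->
  (forall k, lazy_reversible pi (P k.+1)) ->
  (0 < t)%N ->
  lambda <= spectral_gap pi (mat_avg P 0 t) ->
  lambda / t%:R <= 1.
Proof.
move=> pi0 pi1 piu HP t0 gap.
have piW v : 0 <= pi v by exact: ltW.
have P1 k x : \sum_v P k.+1 x v = 1 by exact: kernel_sum1 (HP k) x.
have := @block_contraction R V pi P (fun s v => rho pi P s u v - 1)
  0 t lambda piW HP (fun k => rho_step u pi0 (HP k))
  (mean_rho_sub1 _ _ pi0 pi1 P1) t0 gap.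
move=> /(le_trans (sqnorm_ge0 _ piW)); rewrite sqnorm_rho0 //.
by rewrite pmulr_lge0 ?subr_gt0 ?ltr_pdivlMr ?mul1r // subr_ge0.
Qed.

(** * Numerical estimates *)

Lemma pi_min_gt0 (R : realType) (V : finType) (pi : V -> R) :
  (forall v, 0 < pi v) -> 0 < pi_min pi.
Proof. by move=> pi0; apply: lt_bigmin => // v _. Qed.

Lemma pi_min_le_half (R : realType) (V : finType) (pi : V -> R) :
  (2 <= #|V|)%N -> \sum_v pi v = 1 -> pi_min pi <= 1 / 2%:R.
Proof.
move=> V2 pi1.
have : #|V|%:R * pi_min pi <= 1.
  rewrite -[X in _ <= X]pi1 mulr_natl -sumr_const; apply: ler_sum => v _.
  exact: bigmin_le.
have : 2%:R <= #|V|%:R :> R by rewrite ler_nat.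
have [|qpos] := leP (pi_min pi) 0; nra.
Qed.

(** As [1 - x <= exp (- x)], the left-hand side is at most
    [exp (- 5 log (1 / q)) / q = q ^ 4 <= 1 / 16]. *)
Lemma decay_small (R : realType) (q x : R) (m : nat) :
  0 < q -> q <= 1 / 2%:R -> x <= 1 -> 5%:R * ln (1 / q) <= m%:R * x ->
  (1 - x) ^+ m * (1 / q) <= 1 / 9%:R.
Proof.
move=> q0 q2 x1 mx.
have q5 : (1 - x) ^+ m <= q ^+ 5.
  apply: (@le_trans _ _ (expR (- x) ^+ m)).
    by rewrite lerXn2r ?nnegrE ?subr_ge0 ?expR_ge0 // expR_ge1Dx.
  rewrite -expRM_natl -[q in q ^+ 5]lnK ?posrE // -expRM_natl ler_expR.
  by move: mx; rewrite div1r lnV ?posrE //; lra.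
apply: (@le_trans _ _ (q ^+ 5 * (1 / q))).
  by rewrite ler_wpM2r // divr_ge0 // ltW.
have -> : q ^+ 5 * (1 / q) = q ^+ 4 by field; rewrite gt_eqF.
apply: (@le_trans _ _ ((1 / 2%:R) ^+ 4)); last by lra.
by rewrite lerXn2r ?nnegrE ?divr_ge0 // ltW.
Qed.

Lemma ln_inv_ge_half (R : realType) (q : R) :
  0 < q -> q <= 1 / 2%:R -> 1 / 2%:R <= ln (1 / q).
Proof.
move=> q0 q2; have := expR_ge1Dx (ln q).
by rewrite lnK ?posrE // (div1r q) lnV ?posrE //; lra.
Qed.

Lemma tmix_le (R : realType) (V : finType) (pi : V -> R)
    (P : nat -> V -> V -> R) (s : nat) :
  (forall u, sqnorm pi (fun v => rho pi P s u v - 1) <= 1 / 9%:R) ->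
  (tmix pi P <= (s%:R)%:E)%E.
Proof.
move=> mixed; apply: ereal_inf_lbound; exists s => //= u.
have -> : 1 / 3%:R = Num.sqrt (1 / 9%:R) :> R.
  have -> : 1 / 9%:R = (1 / 3%:R) ^+ 2 :> R by field.
  by rewrite sqrtr_sqr ger0_norm.
by rewrite ler_sqrt // mixed.
Qed.

Theorem mainTheorem3 (R : realType) :
  exists2 K : R, 0 < K &
  forall (V : finType) (G : nat -> rel V) (pi : V -> R) (t : nat) (lambda : R),
    (2 <= #|V|)%N ->
    (forall i, (1 <= i)%N -> undirected_graph (G i)) ->
    let P : nat -> V -> V -> R := fun i => lazy_walk R (G i) in
    prob_dist pi ->
    (forall i, (1 <= i)%N -> stationary pi (P i)) ->
    (1 <= t)%N ->
    0 < lambda ->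
    (forall i, ergodic (mat_avg P i t) /\
               lambda <= spectral_gap pi (mat_avg P i t)) ->
    (tmix pi P <= (K * (t%:R ^+ 2 * ln (1 / pi_min pi) / lambda))%:E)%E.
Proof.
(* 5 comes from the exponent in [decay_small] and 2 from rounding the number of
   blocks up to an integer. *)
exists 7%:R; first by rewrite ltr0n.
move=> V G pi t lambda V2 undir P dist stat t1 lam0 H.
have [piW pi1] := dist.
have HP k : lazy_reversible pi (P k.+1).
  by apply: lazy_walk_reversible; [exact: undir | exact: stat].
have avg0 u v : 0 <= mat_avg P 0 t u v.
  by apply: mat_avg_ge0 => k x y; exact: kernel_ge0 (HP k) x y.
have pi0 v : 0 < pi v.
  have [[irr _] _] := H 0%N; apply: stationary_gt0 dist avg0 irr _.
  by apply: stationary_mat_avg => // k; exact: stat.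
set q := pi_min pi; set L := ln (1 / q).
have q0 : 0 < q by exact: pi_min_gt0.
have q2 : q <= 1 / 2%:R by exact: pi_min_le_half.
have L2 : 1 / 2%:R <= L by exact: ln_inv_ge_half.
have t0 : 0 < t%:R :> R by rewrite ltr0n.
have lt1 : lambda / t%:R <= 1.
  have [u piu] : exists u, pi u < 1.
    have [u _ | none] := pickP V; last by rewrite (eq_card0 none) in V2.
    have [v vu] : exists v, v != u.
      move: V2; rewrite (cardD1 u) inE add1n ltnS => /card_gt0P[v].
      by rewrite !inE andbT => vu; exists v.
    exists u; rewrite -pi1 (bigD1 u) //= (bigD1 v) //= ltrDl.
    by rewrite ltr_pwDl // sumr_ge0.
  exact: gap_le_block_length pi0 pi1 piu HP t1 (proj2 (H 0%N)).
(* The number of blocks is chosen so that m * lambda / t >= 5 * L. *)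
pose y := 5%:R * L * t%:R / lambda.
have y0 : 0 <= y by rewrite divr_ge0 ?mulr_ge0 ?(ltW lam0) //; lra.
have [m ym my] : exists2 m : nat, y <= m%:R & m%:R <= y + 1.
  exists (Num.truncn y).+1; first by rewrite ltW // truncnS_gt.
  by rewrite -natr1 lerD2r truncn_le.
apply: (@le_trans _ _ ((m * t)%:R)%:E).
  apply: tmix_le => u.
  have rate0 : 0 <= 1 - lambda / t%:R by rewrite subr_ge0.
  have gap i := proj2 (H i).
  apply: (le_trans (sqnorm_rho_blocks m u pi0 pi1 HP t1 lt1 gap)).
  apply: le_trans (@decay_small R q _ m q0 q2 lt1 _); last first.
    by rewrite -/L mulrA ler_pdivlMr // -ler_pdivrMr.
  rewrite ler_wpM2l ?exprn_ge0 //.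
  apply: (@le_trans _ _ (1 / pi u)); first by rewrite gerBl.
  rewrite !div1r lef_pV2 ?posrE //; exact: bigmin_le.
rewrite lee_fin natrM.
apply: (@le_trans _ _ ((y + 1) * t%:R)); first by rewrite ler_wpM2r // ltW.
(* One extra block is affordable: lambda <= t and L >= 1 / 2. *)
have -> : 7%:R * (t%:R ^+ 2 * L / lambda) =
          (y + 2%:R * L * t%:R / lambda) * t%:R.
  by rewrite /y; field; rewrite gt_eqF.
rewrite ler_wpM2r ?(ltW t0) // lerD2l ler_pdivlMr // mul1r.
move: lt1; rewrite ler_pdivrMr // mul1r; nra.
Qed.
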